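(* Let $\kappa=0$, and suppose that $A\in C^0(\mathbb{R},\mathrm{SL}(2,\mathbb{R}))\cap C^2(\mathbb{R},\mathbb{M}^2)$ is a solution of $\ddot A(t)=\lambda(t)\,\mathrm{cof}\,A(t)$. Then one of the following holds: - $A$ is rigid; - $|A(t)|\nearrow\infty$ as $|t|\to\infty$; - $\langle A(t),\dot A(t)\rangle>0$ for all $t\in\mathbb{R}$, $|A(t)|\nearrow\infty$ as $t\to\infty$, and $|A(t)|\searrow\sqrt2$ as $t\to-\infty$; or - $\langle A(t),\dot A(t)\rangle<0$ for all $t\in\mathbb{R}$, $|A(t)|\nearrow\infty$ as $t\to-\infty$, and $|A(t)|\searrow\sqrt2$ as $t\to\infty$.
   Context: $\mathbb{M}^2$ is the space of real $2\times2$ matrices with inner product $\langle A,B\rangle=\mathrm{tr}(A^\top B)$ and norm $|A|=\langle A,A\rangle^{1/2}$. $\mathrm{SL}(2,\mathbb{R})=\{A:\det A=1\}$ (on which $|A|\ge\sqrt2$). $Z=\begin{bmatrix}0&-1\\1&0\end{bmatrix}$ and $\mathrm{cof}\,A=ZAZ^\top$ is the cofactor matrix. A solution means that the equation holds for some $\lambda\in C^0(\mathbb{R},\mathbb{R})$ (necessarily $\lambda(t)=-2\det\dot A(t)/|A(t)|^2$). A solution is rigid if $|A(t)|$ is constant in $t$. The notation $f(t)\nearrow\infty$ (respectively $f(t)\searrow c$) as $t\to\infty$ or $t\to-\infty$ means that $f(t)\to\infty$ (respectively $f(t)\to c$) and that, for $|t|$ large, $f$ is monotonically increasing (respectively decreasing)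 as $t$ moves toward the indicated limit; ''as $|t|\to\infty$'' means both as $t\to\infty$ and as $t\to-\infty$. *)

(* Defs.v *)
From HB Require Import structures.
From mathcomp Require Import all_boot all_order all_algebra.
From mathcomp Require Import all_classical all_reals all_analysis.
Set Implicit Arguments.
Unset Strict Implicit.
Unset Printing Implicit Defensive.
Import Order.TTheory GRing.Theory Num.Theory numFieldNormedType.Exports.
Local Open Scope ring_scope.
Local Open Scope classical_set_scope.

(* The library norm on matrices is the sup norm. It is used only through the
   topology (continuity, derivatives), where it is equivalent to the Euclidean
   norm [mx_abs], which is the norm |A| of the text. *)

Definition mx_inner (R : realType) (A B : 'M[R]_2) : R := \tr (A^T *m B).

Definition mx_abs (R : realType) (A : 'M[R]_2) : R := Num.sqrt (mx_inner A A).

Definition Zmx (R : realType) : 'M[R]_2 :=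
  \matrix_(i, j) nth 0 (nth [::] [:: [:: 0; -1]; [:: 1; 0]] i) j.

Definition cof (R : realType) (A : 'M[R]_2) : 'M[R]_2 :=
  Zmx R *m A *m (Zmx R)^T.

Definition SL2 (R : realType) : set 'M[R]_2 := [set A | \det A = 1].

(* [derive1] is a total function, so that the derivability of [f] and [f^`()]
   has to be required separately. *)
Definition C2 (R : realType) (V : normedModType R) (f : R -> V) : Prop :=
  [/\ forall t, derivable f t 1,
      forall t, derivable f^`() t 1
    & continuous f^`(2)].

Definition is_solution (R : realType) (A : R -> 'M[R]_2) : Prop :=
  exists2 lambda : R -> R, continuous lambda &
    forall t, A^`(2) t = lambda t *: cof (A t).

Definition rigid (R : realType) (A : R -> 'M[R]_2) : Prop :=
  exists c : R, forall t, mx_abs (A t) = c.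

(* Monotonicity is strict, and is read as [t] moves towards the limit point:
   towards -oo, "increasing" means that the values grow as [t] decreases. *)
Definition nearrow_pinfty (R : realType) (f : R -> R) : Prop :=
  f t @[t --> +oo] --> +oo /\
  exists T : R, forall s t, T <= s -> s < t -> f s < f t.

Definition nearrow_ninfty (R : realType) (f : R -> R) : Prop :=
  f t @[t --> -oo] --> +oo /\
  exists T : R, forall s t, s <= T -> t < s -> f s < f t.

Definition searrow_pinfty (R : realType) (f : R -> R) (c : R) : Prop :=
  f t @[t --> +oo] --> c /\
  exists T : R, forall s t, T <= s -> s < t -> f t < f s.

Definition searrow_ninfty (R : realType) (f : R -> R) (c : R) : Prop :=
  f t @[t --> -oo] --> c /\
  exists T : R, forall s t, s <= T -> t < s -> f t < f s.

(* Main.v *)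
Require Import Defs.
From mathcomp Require Import all_boot all_order all_algebra.
From mathcomp Require Import all_classical all_reals all_analysis.
From mathcomp Require Import ring lra.
Set Implicit Arguments.
Unset Strict Implicit.
Unset Printing Implicit Defensive.
Import Order.TTheory GRing.Theory Num.Theory numFieldNormedType.Exports.
Local Open Scope ring_scope.
Local Open Scope classical_set_scope.

(** Put the entries of [A = [[a, b], [c, d]]] into a conformal and an
    anticonformal part, [z = (a + d, c - b)] and [w = (a - d, c + b)]. Then
    [4 det A = |z|^2 - |w|^2] and [2 |A|^2 = |z|^2 + |w|^2], and the cofactor
    map fixes [z] and negates [w]. The equation of motion becomes
    [z'' = lam z], [w'' = - lam w] on the quadric [|z|^2 = 4 + |w|^2].

    Let [u = |w|^2], so that [|A|^2 = 2 + u] and [2 <A, A'> = u']. The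
    constraint gives [z.z' = w.w' = u' / 2], hence [E = |z'|^2 + |w'|^2] is
    conserved. Computing [u''] once from [w] and once from [z] and eliminating
    [lam] between the two expressions gives
      [(2 + u) u'' = (4 + u) |w'|^2 + u |z'|^2 >= E u >= 0].
    So [u] is convex, and everything follows from this inequality.

    If [E = 0], the motion is constant. Let [E > 0]. If [u'] and [u''] vanish
    together at some time, then [w] and [w'] vanish there, and Gronwall's
    inequality (the multiplier is bounded by the energy) forces [w = 0] for all
    times: the motion is rigid ([split_motion_profile]). Otherwise either [u']
    has a zero, which is a strict minimum, and convexity drives [u] to infinity
    on both sides; or [u'] has a constant sign, say [u' > 0]. Then [u] tends to
    infinity at [+oo] by convexity ([profile_nearrow_pinfty]), and its infimum
    is 0: were [u] bounded below by [e > 0], the inequality would bound [u'']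
    below by a positive constant on the negative half-line, and [u'] would
    become negative ([profile_searrow_ninfty]). The case [u' < 0] follows by
    reversing time. *)

(** * Calculus on the real line *)

Lemma is_derive_funD (R : realType) (f g : R -> R) (x df dg : R) :
  is_derive x 1 f df -> is_derive x 1 g dg ->
  is_derive x 1 (fun t => f t + g t) (df + dg).
Proof. exact: is_deriveD. Qed.

Lemma is_derive_funB (R : realType) (f g : R -> R) (x df dg : R) :
  is_derive x 1 f df -> is_derive x 1 g dg ->
  is_derive x 1 (fun t => f t - g t) (df - dg).
Proof. exact: is_deriveB. Qed.

Lemma is_derive_funM (R : realType) (f g : R -> R) (x df dg : R) :
  is_derive x 1 f df -> is_derive x 1 g dg ->
  is_derive x 1 (fun t => f t * g t) (f x * dg + g x * df).
Proof. exact: is_deriveM. Qed.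

Lemma is_derive_unique (R : realType) (f : R -> R) (x a b : R) :
  is_derive x 1 f a -> is_derive x 1 f b -> a = b.
Proof. by move=> [_ <-] [_ <-]. Qed.

Lemma is_derive_reflect (R : realType) (f df : R -> R) :
  (forall t : R, is_derive t 1 f (df t)) ->
  forall t : R, is_derive t 1 (fun x => f (- x)) (- df (- t)).
Proof.
move=> Hf t; rewrite -mulrN1; exact: (@is_derive1_comp _ f -%R).
Qed.

Lemma derive_mean_value (R : realType) (f df : R -> R) (a b : R) :
  (forall t : R, is_derive t 1 f (df t)) -> a < b ->
  exists2 c, a < c < b & f b - f a = df c * (b - a).
Proof.
move=> Hf ab; have cf : {within `[a, b], continuous f}.
  by apply: derivable_within_continuous => x _; apply: ex_derive.
have [c] := MVT ab (fun x _ => Hf x) cf.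
by rewrite in_itv /= => ? ?; exists c.
Qed.

Lemma derive_ge0_homo (R : realType) (f df : R -> R) :
  (forall t : R, is_derive t 1 f (df t)) -> (forall t, 0 <= df t) ->
  {homo f : a b / a <= b}.
Proof.
move=> Hf df0 a b; rewrite le_eqVlt => /orP[/eqP->//|ab].
have [c _ e] := derive_mean_value Hf ab.
by rewrite -subr_ge0 e mulr_ge0 // subr_ge0 ltW.
Qed.

(** A nonnegative function whose logarithmic derivative is bounded by [k]
    cannot leave 0, in either direction of time: [g(t) exp(k t)] is
    nondecreasing and [g(t) exp(- k t)] is nonincreasing. *)
Lemma gronwall_zero (R : realType) (g dg : R -> R) (k t0 : R) :
  (forall t : R, is_derive t 1 g (dg t)) -> (forall t, 0 <= g t) ->
  (forall t, `|dg t| <= k * g t) -> g t0 = 0 -> forall t, g t = 0.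
Proof.
move=> Hg g0 dgk gt0.
have exp_derive (c t : R) :
    is_derive t 1 (fun x => expR (c * x)) (c * expR (c * t)).
  have cid : is_derive t 1 ( *%R c) c.
    apply: is_derive_eq (@is_derive_funM _ (cst c) id t 0 1 _ _) _.
    by rewrite /cst /= mulr1 mulr0 addr0.
  have := @is_derive1_comp _ expR ( *%R c) t _ _ (is_derive_expR _) cid.
  by rewrite mulrC.
have homo (c : R) : (forall t, 0 <= dg t + c * g t) ->
    {homo (fun t => g t * expR (c * t)) : a b / a <= b}.
  move=> Hc; apply: (@derive_ge0_homo _ _
    (fun t => g t * (c * expR (c * t)) + expR (c * t) * dg t)) => t.
    exact: is_derive_funM.
  rewrite mulrCA mulrA [expR _ * _]mulrC -mulrDl addrC.
  by rewrite mulr_ge0 ?expR_ge0.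
have zero c t : g t * expR (c * t) <= 0 -> g t = 0.
  rewrite pmulr_lle0 ?expR_gt0 // => ?; apply/eqP.
  by rewrite eq_le g0 andbT.
move=> t; have [tt0|t0t] := leP t t0.
  apply: (zero k t); apply: le_trans (homo k _ _ _ tt0) _.
    by move=> s; have := dgk s; rewrite ler_norml => /andP[? _]; lra.
  by rewrite gt0 mul0r.
apply: (zero (- k) t); rewrite -oppr_ge0 -mulNr.
have negh : {homo (fun t => - (g t * expR (- k * t))) : a b / a <= b}.
  apply: (@derive_ge0_homo _ _ (fun t =>
     - (g t * (- k * expR (- k * t)) + expR (- k * t) * dg t))) => s.
    exact: is_deriveN (is_derive_funM _ _).
  have -> : - (g s * (- k * expR (- k * s)) + expR (- k * s) * dg s) =
    expR (- k * s) * (k * g s - dg s) by ring.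
  rewrite mulr_ge0 ?expR_ge0 // subr_ge0.
  exact: le_trans (ler_norm _) (dgk s).
by rewrite mulNr; have := negh _ _ (ltW t0t); rewrite /= gt0 mul0r oppr0.
Qed.

(** * Time reversal of the limits *)

Lemma nearrow_reflect (R : realType) (f : R -> R) :
  nearrow_pinfty (fun t => f (- t)) -> nearrow_ninfty f.
Proof.
move=> [/cvgryPge Hf [T HT]]; split.
  apply/cvgryPge => M; have [B [_ HB]] := Hf M.
  exists (- B); split; first exact: num_real.
  move=> x xB; have /= := HB (- x); rewrite opprK; apply.
  by rewrite ltrNr.
exists (- T) => s t sT ts; have /= := HT (- s) (- t).
by rewrite !opprK; apply; rewrite ?ltrN2 // lerNr.
Qed.

Lemma searrow_reflect (R : realType) (f : R -> R) (c : R) :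
  searrow_ninfty (fun t => f (- t)) c -> searrow_pinfty f c.
Proof.
move=> [/cvgrPdist_lt Hf [T HT]]; split.
  apply/cvgrPdist_lt => e e0; have [B [_ HB]] := Hf e e0.
  exists (- B); split; first exact: num_real.
  move=> x xB; have /= := HB (- x); rewrite opprK; apply.
  by rewrite ltrNl.
exists (- T) => s t sT ts; have /= := HT (- s) (- t).
by rewrite !opprK; apply; rewrite ?ltrN2 // lerNl.
Qed.

(** * Functions with convexity proportional to their size *)

(** [profile E u u1 u2]: [u] is nonnegative with first and second derivatives
    [u1] and [u2], and satisfies [E u <= (2 + u) u'']. It abstracts what the
    argument uses of [u = |A|^2 - 2] for a motion of energy [E]. *)
Definition profile (R : realType) (E : R) (u u1 u2 : R -> R) : Prop :=
  [/\ forall t : R, is_derive t 1 u (u1 t),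
      forall t : R, is_derive t 1 u1 (u2 t),
      forall t, 0 <= u t
    & forall t, E * u t <= (2 + u t) * u2 t].

Lemma profile_reflect (R : realType) (E : R) (u u1 u2 : R -> R) :
  profile E u u1 u2 ->
  profile E (fun t => u (- t)) (fun t => - u1 (- t)) (fun t => u2 (- t)).
Proof.
move=> [Hu Hu1 u0 Hu2]; split=> // t; first exact: is_derive_reflect.
rewrite -[u2 (- t)]opprK.
exact: is_deriveN (is_derive_reflect Hu1 t).
Qed.

Lemma profile_convex (R : realType) (E : R) (u u1 u2 : R -> R) :
  0 < E -> profile E u u1 u2 -> {homo u1 : a b / a <= b}.
Proof.
move=> E0 [_ Hu1 u0 Hu2]; apply: derive_ge0_homo Hu1 _ => t.
rewrite -(pmulr_rge0 _ (_ : 0 < 2 + u t)); last by have := u0 t; lra.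
by apply: le_trans (Hu2 t); rewrite mulr_ge0 // ltW.
Qed.

Lemma ltr_sqrt2D (R : realType) (x y : R) : 0 <= y ->
  (Num.sqrt (2 + x) < Num.sqrt (2 + y)) = (x < y).
Proof. by move=> y0; rewrite ltr_sqrt ?ltrD2l //; lra. Qed.

Lemma profile_nearrow_pinfty (R : realType) (E t0 : R) (u u1 u2 : R -> R) :
  0 < E -> profile E u u1 u2 -> 0 < u1 t0 ->
  nearrow_pinfty (fun t => Num.sqrt (2 + u t)).
Proof.
move=> E0 prof u1t0; have hom := profile_convex E0 prof.
have [Hu _ u0 _] := prof.
have slope s t : t0 <= s -> s < t -> u1 t0 * (t - s) <= u t - u s.
  move=> t0s st; have [c /andP[sc _] ->] := derive_mean_value Hu st.
  rewrite ler_wpM2r ?subr_ge0 ?(ltW st) //.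
  by apply: hom; apply: le_trans t0s (ltW sc).
split.
  apply/cvgryPge => M.
  exists (Num.max t0 (t0 + M ^+ 2 / u1 t0)); split; first exact: num_real.
  move=> t /=; rewrite gt_max => /andP[t0t Mt].
  apply: le_trans (ler_norm M) _; rewrite -sqrtr_sqr ler_sqrt; last first.
    by have := u0 t; lra.
  have := slope _ _ (lexx _) t0t; have := u0 t0.
  move: Mt; rewrite -ltrBrDl ltr_pdivrMr // mulrC => *; lra.
exists t0 => s t t0s st; rewrite ltr_sqrt2D // -subr_gt0.
by apply: lt_le_trans (slope _ _ t0s st); rewrite mulr_gt0 // subr_gt0.
Qed.

Lemma profile_searrow_ninfty (R : realType) (E : R) (u u1 u2 : R -> R) :
  0 < E -> profile E u u1 u2 -> (forall t, 0 < u1 t) ->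
  searrow_ninfty (fun t => Num.sqrt (2 + u t)) (Num.sqrt 2).
Proof.
move=> E0 [Hu Hu1 u0 Hu2] u1pos.
have incr s t : s < t -> u s < u t.
  move=> st; have [c _ e] := derive_mean_value Hu st.
  by rewrite -subr_gt0 e mulr_gt0 // subr_gt0.
have small e : 0 < e -> exists T, u T < e.
  move=> e0; apply: contrapT => /forallNP ge.
  have {}ge t : e <= u t by rewrite leNgt; apply/negP/ge.
  pose c := E * e / (2 + u 0).
  have d0 : 0 < 2 + u 0 by have := u0 0; lra.
  have c0 : 0 < c by rewrite divr_gt0 // mulr_gt0.
  (* On the negative half-line [e <= u <= u 0], which bounds [u''] below by [c];
     hence [u'] would be nonpositive at the time [- u' 0 / c]. *)
  have u2c t : t < 0 -> c <= u2 t.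
    move=> t0; rewrite /c ler_pdivrMr // [leRHS]mulrC.
    have ut := incr _ _ t0.
    have Eu : E * e <= E * u t by rewrite ler_pM2l.
    have ut0 := u0 t; have H2 := Hu2 t.
    have u2t : 0 <= u2 t.
      rewrite -(pmulr_rge0 _ (_ : 0 < 2 + u t)); last lra.
      by apply: le_trans H2; rewrite mulr_ge0 // ltW.
    apply: le_trans (le_trans Eu H2) _.
    by rewrite ler_wpM2r // lerD2l ltW.
  have T0 : - (u1 0 / c) < 0 by rewrite oppr_lt0 divr_gt0.
  have [x /andP[_ x0]] := derive_mean_value Hu1 T0.
  have := u1pos (- (u1 0 / c)); set v := u1 (- _) => v0 eqv.
  have : c * (u1 0 / c) <= u2 x * (u1 0 / c).
    by rewrite ler_pM2r ?u2c // divr_gt0.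
  have -> : c * (u1 0 / c) = u1 0 by rewrite mulrCA divff ?mulr1 // gt_eqF.
  by move: eqv; rewrite sub0r opprK => <-; lra.
split; last by exists 0 => s t _ ts; rewrite ltr_sqrt2D // incr.
apply/cvgrPdist_lt => e e0.
have [T uT] := small (e ^+ 2) (exprn_gt0 _ e0).
exists T; split; first exact: num_real.
move=> t /= tT; have ut0 := u0 t; have ute := lt_trans (incr _ _ tT) uT.
have le2 : Num.sqrt 2 <= Num.sqrt (2 + u t) by rewrite ler_sqrt; lra.
rewrite distrC ger0_norm ?subr_ge0 // ltrBlDl.
have s2 : 0 <= Num.sqrt (2 : R) by exact: sqrtr_ge0.
have e2 : 0 <= Num.sqrt 2 + e by lra.
rewrite -[ltRHS](ger0_norm e2) -sqrtr_sqr ltr_sqrt; last first.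
  by rewrite exprn_gt0 //; lra.
rewrite sqrrD sqr_sqrtr //.
have : 0 <= Num.sqrt 2 * e by rewrite mulr_ge0 // ltW.
rewrite -mulr_natr => *; lra.
Qed.

(** If [u'] vanishes at [t0] and is nowhere positive, then by monotonicity it
    vanishes on the half-line after [t0], and so does [u''] in its interior. *)
Lemma profile_critical_pos (R : realType) (E t0 : R) (u u1 u2 : R -> R) :
  0 < E -> profile E u u1 u2 ->
  (forall t, u1 t = 0 -> u2 t <> 0) -> u1 t0 = 0 -> exists t, 0 < u1 t.
Proof.
move=> E0 prof nd u1t0; apply: contrapT => /forallNP npos.
have hom := profile_convex E0 prof; have [_ Hu1 _ _] := prof.
have u1z t : t0 <= t -> u1 t = 0.
  move=> t0t; apply/eqP; rewrite eq_le -{2}u1t0 hom // andbT leNgt.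
  exact/negP/npos.
have t1 : t0 <= t0 + 1 by lra.
(* [u'] is 0 on a neighbourhood of [t0 + 1], in particular maximal there. *)
apply: (nd (t0 + 1)); first exact: u1z.
apply: is_derive_unique (Hu1 _) _.
apply: (@derive1_at_max _ _ t0 (t0 + 2)); first by lra.
- by move=> t _; apply: ex_derive.
- by rewrite in_itv /=; lra.
- move=> t; rewrite in_itv /= => /andP[/ltW t0t _].
  by rewrite !u1z.
Qed.

(** The hypothesis that [u'] and [u''] have no common zero excludes the
    constant profile. *)
Lemma profile_alternatives (R : realType) (E : R) (u u1 u2 : R -> R) :
  let N := fun t => Num.sqrt (2 + u t) in
  0 < E -> profile E u u1 u2 -> (forall t, u1 t = 0 -> u2 t <> 0) ->
  [\/ nearrow_pinfty N /\ nearrow_ninfty N,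
      [/\ forall t, 0 < u1 t, nearrow_pinfty N
        & searrow_ninfty N (Num.sqrt 2)]
    | [/\ forall t, u1 t < 0, nearrow_ninfty N
        & searrow_pinfty N (Num.sqrt 2)]].
Proof.
move=> N E0 prof nd; have prof' := profile_reflect prof.
have [[t0 u1t0]|/forallNP nz] := pselect (exists t, u1 t = 0).
  apply: Or31; split.
    have [t] := profile_critical_pos E0 prof nd u1t0.
    exact: profile_nearrow_pinfty E0 prof.
  apply: nearrow_reflect.
  have [||t] := @profile_critical_pos _ _ (- t0) _ _ _ E0 prof'.
  - by move=> t /eqP; rewrite oppr_eq0 => /eqP/nd.
  - by rewrite opprK u1t0 oppr0.
  - exact: profile_nearrow_pinfty E0 prof'.
have [Hu Hu1 _ _] := prof; have hom := profile_convex E0 prof.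
have nsign s t : ~ (u1 s < 0 < u1 t).
  move=> /andP[us ut].
  have st : s <= t.
    by rewrite leNgt; apply/negP => /ltW/hom; rewrite leNgt (lt_trans us ut).
  have [||c _] := @IVT R u1 s t 0 st; last exact: nz.
    by apply: derivable_within_continuous => x _; apply: ex_derive.
  by rewrite ge_min le_max (ltW us) (ltW ut) orbT.
have [[t0 u1t0]|/forallNP npos] := pselect (exists t, 0 < u1 t).
  have pos t : 0 < u1 t.
    rewrite ltNge le_eqVlt; apply/negP => /orP[/eqP/nz//|ut].
    by apply: (nsign t t0); rewrite ut.
  apply: Or32; split=> //.
    exact: profile_nearrow_pinfty E0 prof u1t0.
  exact: profile_searrow_ninfty E0 prof pos.
have neg t : u1 t < 0.
  by rewrite lt_neqAle leNgt; apply/andP; split; [exact/eqP/nz|exact/negP/npos].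
apply: Or33; split=> //.
  apply: nearrow_reflect; apply: (@profile_nearrow_pinfty _ _ 0 _ _ _ E0 prof').
  by rewrite oppr_gt0.
apply: searrow_reflect; apply: (profile_searrow_ninfty E0 prof').
by move=> t; rewrite oppr_gt0.
Qed.

(** * The equation in conformal coordinates *)

Lemma is_derive_norm2 (R : realType) (f g : R -> R) (x df dg : R) :
  is_derive x 1 f df -> is_derive x 1 g dg ->
  is_derive x 1 (fun t => f t ^+ 2 + g t ^+ 2) (2 * (f x * df + g x * dg)).
Proof.
move=> Hf Hg.
apply: is_derive_eq (is_derive_funD (is_derive_funM Hf Hf)
  (is_derive_funM Hg Hg)) _.
by ring.
Qed.

Lemma is_derive_dot (R : realType) (f g f1 g1 : R -> R) (x f2 g2 : R) :
  is_derive x 1 f (f1 x) -> is_derive x 1 g (g1 x) ->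
  is_derive x 1 f1 f2 -> is_derive x 1 g1 g2 ->
  is_derive x 1 (fun t => 2 * (f t * f1 t + g t * g1 t))
    (2 * (f1 x ^+ 2 + g1 x ^+ 2 + (f x * f2 + g x * g2))).
Proof.
move=> Hf Hg Hf1 Hg1.
apply: is_derive_eq (is_derive_funM (is_derive_cst (2 : R) x 1)
  (is_derive_funD (is_derive_funM Hf Hf1) (is_derive_funM Hg Hg1))) _.
by rewrite /cst; ring.
Qed.

(** The equation of motion in the coordinates [z = (p, q)], [w = (r, s)], with
    velocities [z' = (p1, q1)], [w' = (r1, s1)] and multiplier [lam], together
    with the constraint [|z|^2 = 4 + |w|^2] which expresses [det A = 1]. *)
Definition split_motion (R : realType)
    (lam p q r s p1 q1 r1 s1 : R -> R) : Prop :=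
  [/\ forall t : R, is_derive t 1 p (p1 t) /\ is_derive t 1 q (q1 t),
      forall t : R, is_derive t 1 r (r1 t) /\ is_derive t 1 s (s1 t),
      forall t : R, is_derive t 1 p1 (lam t * p t) /\
                    is_derive t 1 q1 (lam t * q t),
      forall t : R, is_derive t 1 r1 (- lam t * r t) /\
                    is_derive t 1 s1 (- lam t * s t)
    & forall t, p t ^+ 2 + q t ^+ 2 = 4 + (r t ^+ 2 + s t ^+ 2)].

Lemma split_motion_dot (R : realType) (lam p q r s p1 q1 r1 s1 : R -> R) :
  split_motion lam p q r s p1 q1 r1 s1 ->
  forall t, p t * p1 t + q t * q1 t = r t * r1 t + s t * s1 t.
Proof.
move=> [Hz Hw _ _ C] t; have [Hp Hq] := Hz t; have [Hr Hs] := Hw t.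
have dz := is_derive_norm2 Hp Hq.
have dw := is_derive_funD (is_derive_cst (4 : R) t 1) (is_derive_norm2 Hr Hs).
rewrite (_ : (fun t => _) = (fun t => cst 4 t + (r t ^+ 2 + s t ^+ 2))) in dz.
  by have := is_derive_unique dz dw; lra.
by apply/funext => x; rewrite C.
Qed.

(** Comparison of the second derivatives of [|z|^2] and [|w|^2]. *)
Lemma split_motion_multiplier (R : realType)
    (lam p q r s p1 q1 r1 s1 : R -> R) :
  split_motion lam p q r s p1 q1 r1 s1 ->
  forall t, lam t * (4 + 2 * (r t ^+ 2 + s t ^+ 2)) =
    (r1 t ^+ 2 + s1 t ^+ 2) - (p1 t ^+ 2 + q1 t ^+ 2).
Proof.
move=> M t; have dotE := split_motion_dot M; have [Hz Hw Hz1 Hw1 C] := M.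
have [Hp Hq] := Hz t; have [Hr Hs] := Hw t.
have [Hp1 Hq1] := Hz1 t; have [Hr1 Hs1] := Hw1 t.
have dz := is_derive_dot Hp Hq Hp1 Hq1.
have dw := is_derive_dot Hr Hs Hr1 Hs1.
rewrite (_ : (fun t => _) = (fun t => 2 * (r t * r1 t + s t * s1 t))) in dz.
  have := is_derive_unique dz dw.
  have -> : p t * (lam t * p t) + q t * (lam t * q t) =
    lam t * (p t ^+ 2 + q t ^+ 2) by ring.
  by rewrite C; lra.
by apply/funext => x; rewrite dotE.
Qed.

Lemma split_motion_energy (R : realType) (lam p q r s p1 q1 r1 s1 : R -> R) :
  split_motion lam p q r s p1 q1 r1 s1 ->
  exists E, forall t,
    (p1 t ^+ 2 + q1 t ^+ 2) + (r1 t ^+ 2 + s1 t ^+ 2) = E.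
Proof.
move=> M; have dotE := split_motion_dot M; have [_ _ Hz1 Hw1 _] := M.
pose e t := (p1 t ^+ 2 + q1 t ^+ 2) + (r1 t ^+ 2 + s1 t ^+ 2).
exists (e 0) => t; apply: (is_derive_0_is_cst (f := e)) => {}t.
have [Hp1 Hq1] := Hz1 t; have [Hr1 Hs1] := Hw1 t.
apply: is_derive_eq
  (is_derive_funD (is_derive_norm2 Hp1 Hq1) (is_derive_norm2 Hr1 Hs1)) _.
have -> : 2 * (p1 t * (lam t * p t) + q1 t * (lam t * q t)) +
    2 * (r1 t * (- lam t * r t) + s1 t * (- lam t * s t)) =
  2 * lam t * ((p t * p1 t + q t * q1 t) - (r t * r1 t + s t * s1 t)) by ring.
by rewrite dotE subrr mulr0.
Qed.

(** Uniqueness for the linear equation [w'' = - lam w] with zero initial data,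
    by Gronwall applied to [|w|^2 + |w'|^2]. *)
Lemma split_motion_vanish (R : realType) (lam p q r s p1 q1 r1 s1 : R -> R)
    (t0 : R) :
  split_motion lam p q r s p1 q1 r1 s1 ->
  r t0 = 0 -> s t0 = 0 -> r1 t0 = 0 -> s1 t0 = 0 ->
  forall t, r t ^+ 2 + s t ^+ 2 = 0.
Proof.
move=> M r0 s0 r10 s10; have lamE := split_motion_multiplier M.
have [E HE] := split_motion_energy M; have [_ Hw _ Hw1 _] := M.
pose g t := (r t ^+ 2 + s t ^+ 2) + (r1 t ^+ 2 + s1 t ^+ 2).
pose dg t := 2 * (1 - lam t) * (r t * r1 t + s t * s1 t).
suff gz t : g t = 0.
  move=> t; have := gz t; rewrite /g.
  have := sqr_ge0 (r t); have := sqr_ge0 (s t).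
  by have := sqr_ge0 (r1 t); have := sqr_ge0 (s1 t); lra.
apply: (@gronwall_zero _ g dg (1 + E) t0) => {t}.
- move=> t; have [Hr Hs] := Hw t; have [Hr1 Hs1] := Hw1 t.
  apply: is_derive_eq
    (is_derive_funD (is_derive_norm2 Hr Hs) (is_derive_norm2 Hr1 Hs1)) _.
  by rewrite /dg; ring.
- by move=> t; rewrite /g !addr_ge0 ?sqr_ge0.
- move=> t; rewrite /dg -mulrA mulrCA normrM.
  have lamE' := lamE t; have HE' := HE t.
  have [a b] : 0 <= r t ^+ 2 + s t ^+ 2 /\ 0 <= r1 t ^+ 2 + s1 t ^+ 2.
    by rewrite !addr_ge0 ?sqr_ge0.
  have c : 0 <= p1 t ^+ 2 + q1 t ^+ 2 by rewrite addr_ge0 ?sqr_ge0.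
  have lamB : `|1 - lam t| <= 1 + E.
    apply: le_trans (ler_normB _ _) _; rewrite normr1 lerD2l.
    (* The multiplier is bounded by the energy: [4 |lam| <= E]. *)
    have : `|lam t * (4 + 2 * (r t ^+ 2 + s t ^+ 2))| <= E.
      by rewrite lamE' ler_norml; lra.
    rewrite normrM [X in _ * X]ger0_norm; last by lra.
    have : 0 <= `|lam t| * (r t ^+ 2 + s t ^+ 2) by rewrite mulr_ge0.
    by have := normr_ge0 (lam t); lra.
  apply: ler_pM lamB _ => //; rewrite /g ler_norml.
  have := sqr_ge0 (r t + r1 t); have := sqr_ge0 (r t - r1 t).
  have := sqr_ge0 (s t + s1 t); have := sqr_ge0 (s t - s1 t).
  by move=> *; apply/andP; split; lra.
- by rewrite /g r0 s0 r10 s10 expr0n /= !addr0.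
Qed.

(** Either the motion is rigid, or [u = |w|^2] is a profile without degenerate
    critical points. *)
Lemma split_motion_profile (R : realType) (lam p q r s p1 q1 r1 s1 : R -> R) :
  split_motion lam p q r s p1 q1 r1 s1 ->
  let u := fun t => r t ^+ 2 + s t ^+ 2 in
  let u1 := fun t => 2 * (r t * r1 t + s t * s1 t) in
  (exists c, forall t, u t = c) \/
  exists E u2, [/\ 0 < E, profile E u u1 u2 & forall t, u1 t = 0 -> u2 t <> 0].
Proof.
move=> M u u1; have lamE := split_motion_multiplier M.
have [E HE] := split_motion_energy M; have [_ Hw _ Hw1 _] := M.
have w10 t : 0 <= r1 t ^+ 2 + s1 t ^+ 2 by rewrite addr_ge0 ?sqr_ge0.
have z10 t : 0 <= p1 t ^+ 2 + q1 t ^+ 2 by rewrite addr_ge0 ?sqr_ge0.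
have u0 t : 0 <= u t by rewrite addr_ge0 ?sqr_ge0.
have sq0 (x y : R) : x ^+ 2 + y ^+ 2 = 0 -> x = 0 /\ y = 0.
  move=> /eqP; rewrite paddr_eq0 ?sqr_ge0 // !sqrf_eq0.
  by move=> /andP[/eqP-> /eqP->].
have Hu (t : R) : is_derive t 1 u (u1 t).
  by have [Hr Hs] := Hw t; exact: is_derive_norm2 Hr Hs.
have E0 : 0 <= E by rewrite -(HE 0) addr_ge0.
move: E0; rewrite le_eqVlt => /orP[/eqP E0|E0].
  left; exists (u 0) => t; apply: is_derive_0_is_cst => {}t.
  apply: is_derive_eq (Hu t) _.
  rewrite /u1; have [|-> ->] := sq0 (r1 t) (s1 t).
    by have := HE t; have := w10 t; have := z10 t; lra.
  by rewrite !mulr0 addr0 mulr0.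
pose u2 t := 2 * ((r1 t ^+ 2 + s1 t ^+ 2) - lam t * u t).
(* Eliminating the multiplier. *)
have u2E t : (2 + u t) * u2 t =
    (4 + u t) * (r1 t ^+ 2 + s1 t ^+ 2) + u t * (p1 t ^+ 2 + q1 t ^+ 2).
  have -> : (2 + u t) * u2 t = 2 * (2 + u t) * (r1 t ^+ 2 + s1 t ^+ 2) -
     u t * (lam t * (4 + 2 * u t)) by rewrite /u2; ring.
  by rewrite lamE; ring.
have prof : profile E u u1 u2.
  split=> // t.
    have [Hr Hs] := Hw t; have [Hr1 Hs1] := Hw1 t.
    apply: is_derive_eq (is_derive_dot Hr Hs Hr1 Hs1) _.
    by rewrite /u2 /u; ring.
  rewrite u2E -(HE t); by have := w10 t; move: (u t) => a; lra.
have [[t0 [u1t0 u2t0]]|/forallNP nd] :=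
  pselect (exists t, u1 t = 0 /\ u2 t = 0).
  left; exists 0.
  have [_ _ _ /(_ t0)] := prof; rewrite u2t0 mulr0 pmulr_rle0 // => ut0.
  have ut0' : u t0 = 0 by apply/eqP; rewrite eq_le ut0 u0.
  have [rt0 st0] := sq0 _ _ ut0'.
  have [r1t0 s1t0] : r1 t0 = 0 /\ s1 t0 = 0.
    by apply: sq0; move: u2t0; rewrite /u2 ut0' mulr0; lra.
  exact: split_motion_vanish M rt0 st0 r1t0 s1t0.
by right; exists E, u2; split=> // t a b; apply: (nd t).
Qed.

(** * From matrices to coordinates *)

Lemma sum_ord2 (V : nmodType) (F : 'I_2 -> V) : \sum_i F i = F 0 + F 1.
Proof.
rewrite !big_ord_recl big_ord0 addr0; congr (_ + F _).
exact/val_inj.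
Qed.

Lemma det_mx22 (R : comNzRingType) (M : 'M[R]_2) :
  \det M = M 0 0 * M 1 1 - M 0 1 * M 1 0.
Proof.
rewrite (expand_det_row _ 0) sum_ord2 /cofactor !det_mx11 !mxE.
have e (i : 'I_1) : lift (0 : 'I_2) i = 1 by apply/val_inj; rewrite ord1.
have e' (i : 'I_1) : lift (1 : 'I_2) i = 0 by apply/val_inj; rewrite ord1.
by rewrite !e e' /= expr0 expr1 mul1r mulN1r mulrN.
Qed.

Lemma mx_innerE (R : realType) (M N : 'M[R]_2) :
  mx_inner M N =
  M 0 0 * N 0 0 + M 1 0 * N 1 0 + (M 0 1 * N 0 1 + M 1 1 * N 1 1).
Proof. by rewrite /mx_inner /mxtrace sum_ord2 !mxE !sum_ord2 !mxE. Qed.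

Lemma cofE (R : realType) (M : 'M[R]_2) :
  [/\ cof M 0 0 = M 1 1, cof M 0 1 = - M 1 0,
      cof M 1 0 = - M 0 1 & cof M 1 1 = M 0 0].
Proof.
by split; rewrite /cof /Zmx !mxE !sum_ord2 !mxE !sum_ord2 !mxE /=; ring.
Qed.

Lemma is_derive_entry (R : realType) (F : R -> 'M[R]_2) (t : R) (i j : 'I_2) :
  derivable F t 1 -> is_derive t 1 (fun x => F x i j) (derive1 F t i j).
Proof.
move=> dF; apply: DeriveDef; first exact: (derivable_mxP _ _ _).1 dF i j.
by rewrite derive1E derive_mx // mxE.
Qed.

Theorem theorem12p1 (R : realType) (A : R -> 'M[R]_2)
    (A_C0 : continuous A) (A_SL2 : forall t, SL2 (A t)) (A_C2 : C2 A)
    (A_sol : is_solution A) :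
  [\/ rigid A,
      nearrow_pinfty (fun t => mx_abs (A t)) /\
      nearrow_ninfty (fun t => mx_abs (A t)),
      [/\ forall t, 0 < mx_inner (A t) (derive1 A t),
          nearrow_pinfty (fun t => mx_abs (A t))
        & searrow_ninfty (fun t => mx_abs (A t)) (Num.sqrt 2)]
    | [/\ forall t, mx_inner (A t) (derive1 A t) < 0,
          nearrow_ninfty (fun t => mx_abs (A t))
        & searrow_pinfty (fun t => mx_abs (A t)) (Num.sqrt 2)]].
Proof.
have [lam _ Hlam] := A_sol; have [dA dA1 _] := A_C2.
pose p t := A t 0 0 + A t 1 1; pose q t := A t 1 0 - A t 0 1.
pose r t := A t 0 0 - A t 1 1; pose s t := A t 1 0 + A t 0 1.
pose p1 t := derive1 A t 0 0 + derive1 A t 1 1.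
pose q1 t := derive1 A t 1 0 - derive1 A t 0 1.
pose r1 t := derive1 A t 0 0 - derive1 A t 1 1.
pose s1 t := derive1 A t 1 0 + derive1 A t 0 1.
have det1 t : A t 0 0 * A t 1 1 - A t 0 1 * A t 1 0 = 1.
  by rewrite -det_mx22; exact: A_SL2.
have M : split_motion lam p q r s p1 q1 r1 s1.
  have d i j t := is_derive_entry i j (dA t).
  have d1 i j t := is_derive_entry i j (dA1 t).
  have A2 i j t : derive1 (derive1 A) t i j = lam t * cof (A t) i j.
    by have := Hlam t; rewrite /derive1n /= => ->; rewrite mxE.
  split=> t; first by split; [exact: is_derive_funD|exact: is_derive_funB].
  - by split; [exact: is_derive_funB|exact: is_derive_funD].
  - have [c00 c01 c10 c11] := cofE (A t); split.
      apply: is_derive_eq (is_derive_funD (d1 0 0 t) (d1 1 1 t)) _.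
      by rewrite !A2 c00 c11 /p; ring.
    apply: is_derive_eq (is_derive_funB (d1 1 0 t) (d1 0 1 t)) _.
    by rewrite !A2 c01 c10 /q; ring.
  - have [c00 c01 c10 c11] := cofE (A t); split.
      apply: is_derive_eq (is_derive_funB (d1 0 0 t) (d1 1 1 t)) _.
      by rewrite !A2 c00 c11 /r; ring.
    apply: is_derive_eq (is_derive_funD (d1 1 0 t) (d1 0 1 t)) _.
    by rewrite !A2 c01 c10 /s; ring.
  - have := det1 t; rewrite /p /q /r /s; lra.
have absE : (fun t => mx_abs (A t)) =
    (fun t => Num.sqrt (2 + (r t ^+ 2 + s t ^+ 2))).
  apply/funext => t; rewrite /mx_abs mx_innerE; congr Num.sqrt.
  have := det1 t; rewrite /r /s; lra.
have innerE t : mx_inner (A t) (derive1 A t) = r t * r1 t + s t * s1 t.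
  have := split_motion_dot M t; rewrite mx_innerE /p /q /r /s /p1 /q1 /r1 /s1.
  lra.
have [[c uc]|[E [u2 [E0 prof nd]]]] := split_motion_profile M.
  apply: Or41; exists (Num.sqrt (2 + c)) => t.
  by rewrite -(uc t); have := congr1 (@^~ t) absE.
rewrite absE; have [?|[pos ? ?]|[neg ? ?]] := profile_alternatives E0 prof nd.
- exact: Or42.
- apply: Or43; split=> // t; rewrite innerE; have := pos t; lra.
- apply: Or44; split=> // t; rewrite innerE; have := neg t; lra.
Qed.
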